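(* Fix $W>0$ and consider the system $y_{t+1}=a\phi_b(y_t)+u_t+w_{t+1}$, $t\ge0$, with disturbances satisfying $\sup_{t\ge1}|w_t|\le W$. Let $\mathcal A=[a_{\min},a_{\max}]\subset\mathbb R$ be a nondegenerate compact interval (which may contain zero), and let $\mathcal B\subset(0,\infty)$ be a nonempty finite set. The family $\mathcal A\times\mathcal B$ is robustly stabilizable if and only if $\max_{b\in\mathcal B}b<4$. When the maximum is below $4$, there is a feedback law (a single one, not depending on $Y$) such that for every $Y\ge0$ $$\sup_{\substack{p^\star\in\mathcal A\times\mathcal B,\ |y_0|\le Y\\ (w_k)_{k\ge1}:\ \sup_k|w_k|\le W}}\ \sup_{t\ge0}|y_t|<\infty .$$
   Context: For $b>0$ and $y\in\mathbb R$, $\phi_b(y)=\operatorname{sgn}(y)|y|^b$ (so $\phi_b(0)=0$). The state is $y_t\in\mathbb R$, the input is $u_t\in\mathbb R$, and the true parameter $p^\star=(a^\star,b^\star)\in\mathbb R\times(0,\infty)$ is unknown to the controller; trajectories are generated by $y_{t+1}=a^\star\phi_{b^\star}(y_t)+u_t+w_{t+1}$. A feedback law is a sequence $\mu=(\mu_t)_{t\ge0}$ of maps $\mu_t:\mathbb R^{t+1}\to\mathbb R$ (no regularity required) with $u_t=\mu_t(y_0,\ldots,y_t)$; it may depend on the prescribed parameter set and on $W$, but not on $p^\star$ or the disturbances. A nonempty set $\mathcal P\subset\mathbb R\times(0,\infty)$ is robustly stabilizable if there is a feedback law such that $\sup_{t\ge0}|y_t|<\infty$ for every $p^\star\in\mathcal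 P$, every $y_0\in\mathbb R$, and every disturbance sequence with $\sup_{t\ge1}|w_t|\le W$. *)

(* Defs.v *)
From HB Require Import structures.
From mathcomp Require Import all_boot all_order all_algebra finmap.
From mathcomp Require Import all_classical all_reals all_analysis.
Set Implicit Arguments.
Unset Strict Implicit.
Unset Printing Implicit Defensive.
Import Order.TTheory GRing.Theory Num.Theory.
Import numFieldNormedType.Exports.
Local Open Scope classical_set_scope.
Local Open Scope ring_scope.

Section ClosedLoop.
Variable R : realType.

Definition phi (b y : R) : R := Num.sg y * `|y| `^ b.

(* The t-th map acts on the whole output history (y_0, ..., y_t). *)
Definition feedback := forall t : nat, 'rV[R]_t.+1 -> R.

(* The parameter is p = (a, b). The value w 0 never enters the dynamics. *)
Definition trajectory (mu : feedback) (p : R * R) (w y : nat -> R) :=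
  forall t : nat,
    y t.+1 = p.1 * phi p.2 (y t) + mu t (\row_(i < t.+1) y i) + w t.+1.

Definition admissible_disturbance (W : R) (w : nat -> R) :=
  (ereal_sup [set `|w t|%:E | t in [set t | (1 <= t)%N]] <= W%:E)%E.

Definition sup_abs (y : nat -> R) : \bar R :=
  ereal_sup (range (fun t => `|y t|%:E)).

(* The initial condition is y 0; it determines y together with mu, p and w. *)
Definition robustly_stabilizable (W : R) (P : set (R * R)) :=
  exists mu : feedback, forall (p : R * R) (w y : nat -> R),
    P p -> admissible_disturbance W w -> trajectory mu p w y ->
    (sup_abs y < +oo)%E.

Definition trajectories_from (mu : feedback) (W : R) (P : set (R * R)) (Y : R)
    : set (nat -> R) :=
  [set y | exists p w, [/\ P p, `|y 0%N| <= Y, admissible_disturbance W w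
                         & trajectory mu p w y]].

Definition uniform_bound (mu : feedback) (W : R) (P : set (R * R)) (Y : R)
    : \bar R :=
  ereal_sup [set sup_abs y | y in trajectories_from mu W P Y].

(* The maximum of a nonempty finite set of positive reals: the default value 0
   is then below every element. *)
Definition fset_max (B : {fset R}) : R := \big[Num.max/0]_(b <- B) b.

End ClosedLoop.

(* Main.v *)
Require Import Defs.
From HB Require Import structures.
From mathcomp Require Import all_boot all_order all_algebra finmap.
From mathcomp Require Import all_classical all_reals all_analysis.
From mathcomp Require Import ring lra.
Set Implicit Arguments.
Unset Strict Implicit.
Unset Printing Implicit Defensive.
Import Order.TTheory GRing.Theory Num.Theory.
Import numFieldNormedType.Exports.
Local Open Scope classical_set_scope.
Local Open Scope ring_scope.

(** Both directions compare logarithms x_t = ln |y_t| with the recursion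
      x_(t+1) = b (x_t - x_(t-1)) + const,
    whose characteristic equation r^2 - b r + b = 0 has a real root exactly
    when b >= 4. The recursion arises because the best knowledge of a available
    at time t comes from the largest earlier output y_s: it has error of order
    W / |y_s|^b, which the next step amplifies by |y_t|^b.

    Necessity. Let b >= 4 be one of the exponents. Against any feedback, an
    opponent maintains an interval of gains compatible with everything observed
    so far, and answers each input with zero noise and the endpoint of that
    interval that gives the larger output; the new interval then has length
    W / |y_t|^b ([adversaryP]). The inequality
    4 |y_t|^2 / W <= length * |y_t|^b propagates precisely because b >= 4, and
    it forces |y_(t+1)| >= 2 |y_t| ([far_output_escapes]). A gain in all the
    nested intervals explains the whole unbounded trajectory with noise bounded
    by W ([quartic_unstable]).

    Sufficiency. The law is certainty equivalence: pick any parameter (a, b) of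
    the family that is consistent with the past, and cancel a phi_b(y_t). If
    the picked exponent b is still consistent with some gain a' after the next
    output, then a and a' both explain the past under that same b, and the
    output is as small as if b were the true exponent
    ([unrefuted_exponent_bound]). Otherwise b is refuted for good, and the
    output is at most a fixed polynomial in |y_t|; this happens at most #|B|
    times. Between two refutations, let x be the logarithm of the running
    maximum of |y|. By the arithmetic-geometric inequality,
      beta (x_t - x_(t-1)) <= (beta / 4) x_t^2 / x_(t-1),
    so if beta = max B < 4 the ratio of consecutive values of x falls
    geometrically until it reaches 1, and x stops growing after a number of
    steps that depends only on the initial size ([damped_growth_bounded]).
    Alternating these two kinds of growth finitely often gives a bound that
    depends on the trajectory only through the bound on |y_0|
    ([finitely_many_lessons_bounded]). *)

(** * The nonlinearity, the disturbances and the supremum of a trajectory *)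

Lemma normr_phi (R : realType) (b y : R) : 0 < b -> `|phi b y| = `|y| `^ b.
Proof.
move=> b0; rewrite /phi normrM (ger0_norm (powR_ge0 _ _)) normr_sg.
have [->|y0] := eqVneq y 0; last by rewrite mul1r.
by rewrite mul0r normr0 powR0 // gt_eqF.
Qed.

Lemma admissible_disturbanceP (R : realType) (W : R) (w : nat -> R) :
  admissible_disturbance W w <-> forall t, (1 <= t)%N -> `|w t| <= W.
Proof.
split=> [adm t t1|wW].
  by rewrite -lee_fin; apply: le_trans adm; apply: ereal_sup_ubound; exists t.
by apply: ge_ereal_sup => _ [t t1 <-]; rewrite lee_fin; exact: wW.
Qed.

Lemma sup_abs_le (R : realType) (y : nat -> R) (M : R) :
  (forall t, `|y t| <= M) -> (sup_abs y <= M%:E)%E.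
Proof. by move=> yM; apply: ge_ereal_sup => _ [t _ <-]; rewrite lee_fin. Qed.

Lemma sup_abs_lty (R : realType) (y : nat -> R) :
  (sup_abs y < +oo)%E -> exists M, forall t, `|y t| <= M.
Proof.
move=> ylt; exists (fine (sup_abs y)) => t.
have le_sup : (`|y t|%:E <= sup_abs y)%E by apply: ereal_sup_ubound; exists t.
rewrite -lee_fin fineK // fin_real // ylt andbT.
exact: lt_le_trans (ltNyr _) le_sup.
Qed.

(** * An opponent defeating every feedback when some exponent is at least 4 *)

(** A feedback reads a row vector of growing length, so the outputs cannot be
    defined by plain recursion on [nat]: the proof carries the whole past as a
    function and reads off its diagonal. The extra state [S] holds the
    opponent's interval of gains. *)
Lemma causal_recursion (R : realType) (S : Type) (y0 : R) (s0 : S)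
    (F : forall t, 'rV[R]_t.+1 -> S -> R * S) :
  exists y s, [/\ y 0%N = y0, s 0%N = s0 &
    forall t, (y t.+1, s t.+1) = F t (\row_(i < t.+1) y i) (s t)].
Proof.
pose step t (st : (nat -> R) * S) :=
  let r := F t (\row_(i < t.+1) st.1 i) st.2 in
  ((fun k => if k == t.+1 then r.1 else st.1 k), r.2).
pose fix run t := if t is u.+1 then step u (run u) else (fun=> y0, s0).
have runE t k : (k <= t)%N -> (run t).1 k = (run k).1 k.
  elim: t => [|t IHt]; first by rewrite leqn0 => /eqP ->.
  rewrite leq_eqVlt => /predU1P[-> //|kt].
  by rewrite /= ltn_eqF // IHt.
exists (fun t => (run t).1 t), (fun t => (run t).2); split=> // t.
rewrite /= eqxx -surjective_pairing; congr (F t _ _).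
by apply/rowP => i; rewrite !mxE runE // -ltnS.
Qed.

Lemma nested_intervals (R : realType) (l r : nat -> R) :
  (forall t, l t <= l t.+1) -> (forall t, r t.+1 <= r t) ->
  (forall t, l t <= r t) -> exists a, forall t, l t <= a <= r t.
Proof.
move=> lS rS lr.
have lm : {homo l : m n / (m <= n)%N >-> m <= n} by apply: homo_leq => //; exact: le_trans.
have rm : {homo r : m n / (m <= n)%N >-> n <= m}.
  by apply: homo_leq => // y x z xy yz; exact: le_trans yz xy.
have ub t : ubound (range l) (r t).
  move=> _ [s _ <-]; apply: le_trans (lm _ _ (leq_maxl s t)) _.
  by apply: le_trans (lr _) (rm _ _ (leq_maxr s t)).
exists (sup (range l)) => t; apply/andP; split.
  by apply: ub_le_sup; [exists (r 0%N); exact: ub|exists t].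
by apply: ge_sup; [exists (l 0%N); exists 0%N|exact: ub].
Qed.

(** The next output and the next interval of gains, when the gain is known to
    lie in [l, r], the regressor is f and the input is u. *)
Definition adversary (R : realType) (W l r f u : R) : R * (R * R) :=
  if `|r * f + u| <= `|l * f + u|
  then (l * f + u, (l, l + W / `|f|)) else (r * f + u, (r - W / `|f|, r)).

(** The two endpoint predictions are (r - l) |f| apart, so one of them has at
    least half that size. A gain within W / |f| of the chosen endpoint explains
    the same output with noise at most W. *)
Lemma adversaryP (R : realType) (W l r f u : R) :
  0 <= W -> f != 0 -> W / `|f| <= r - l ->
  let q := adversary W l r f u in
    [/\ (r - l) * `|f| / 2 <= `|q.1|,
        l <= q.2.1, q.2.2 <= r,
        q.2.2 - q.2.1 = W / `|f| &
        forall a, q.2.1 <= a <= q.2.2 -> `|q.1 - u - a * f| <= W].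
Proof.
move=> W0 f0 Wlr q; have nf0 : 0 < `|f| by rewrite normr_gt0.
have WE : W = W / `|f| * `|f| by rewrite divfK // gt_eqF.
have W'0 : 0 <= W / `|f| by rewrite divr_ge0.
have far : (r - l) * `|f| <= `|l * f + u| + `|r * f + u|.
  have lr : 0 <= r - l by apply: le_trans Wlr.
  rewrite -[X in X * _](ger0_norm lr) -normrM [leRHS]addrC.
  by rewrite (_ : (r - l) * f = (r * f + u) - (l * f + u)); [exact: ler_normB|ring].
rewrite {}/q /adversary; have [le_lr|lt_rl] := lerP `|r * f + u| `|l * f + u|.
- split=> /=; [lra|lra|lra|lra|].
  move=> a aI; rewrite [X in `|X|](_ : _ = (l - a) * f); last by ring.
  by rewrite normrM [leRHS]WE ler_wpM2r // ler_norml; lra.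
- split=> /=; [lra|lra|lra|lra|].
  move=> a aI; rewrite [X in `|X|](_ : _ = (r - a) * f); last by ring.
  by rewrite normrM [leRHS]WE ler_wpM2r // ler_norml; lra.
Qed.

(** Here and below, z is the size of the output and l the length of the interval
    of gains. The conclusion W / z^b <= l makes room for the next interval
    inside the present one. *)
Lemma plausible_interval_shrinks (R : realType) (W b l z : R) :
  0 < W -> W <= z -> 4 / W * z ^+ 2 <= l * z `^ b ->
  4 * z <= 4 / W * z ^+ 2 /\ W / z `^ b <= l.
Proof.
move=> W0 Wz inv; have z0 : 0 < z by exact: lt_le_trans Wz.
have W40 : 0 < 4 / W by rewrite divr_gt0.
have z2 : 4 * z <= 4 / W * z ^+ 2.
  have -> : 4 * z = 4 / W * (W * z) by rewrite mulrA divfK // gt_eqF.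
  by rewrite (ler_pM2l W40) expr2 (ler_pM2r z0).
by split=> //; rewrite ler_pdivrMr ?powR_gt0 //; apply: le_trans inv; lra.
Qed.

(** With rho = z1 / z >= 1, the new product is W rho^b >= W rho^4, and the
    invariant gives W rho >= 2 z; so W rho^4 >= (2 z)^2 rho^2 / W
    = 4 z1^2 / W. This is where b >= 4 is used. *)
Lemma far_output_escapes (R : realType) (W b l z z1 : R) :
  0 < W -> 4 <= b -> W <= z -> 4 / W * z ^+ 2 <= l * z `^ b ->
  l * z `^ b / 2 <= z1 ->
  2 * z <= z1 /\ 4 / W * z1 ^+ 2 <= W / z `^ b * z1 `^ b.
Proof.
move=> W0 b4 Wz inv far.
have z0 : 0 < z by exact: lt_le_trans Wz.
have zb0 : 0 < z `^ b by exact: powR_gt0.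
have W40 : 0 < 4 / W by rewrite divr_gt0.
have WW : 4 / W * W = 4 by rewrite divfK // gt_eqF.
have zz1 : 4 / W * z ^+ 2 <= 2 * z1 by lra.
have [z2 _] := plausible_interval_shrinks W0 Wz inv.
split; first lra.
have z10 : 0 < z1 by lra.
pose rho := z1 / z.
have rhoE : rho * z = z1 by rewrite divfK // gt_eqF.
have rho1 : 1 <= rho by rewrite ler_pdivlMr // mul1r; lra.
have rho0 : 0 <= rho by lra.
have -> : W / z `^ b * z1 `^ b = rho `^ b * W.
  rewrite -rhoE powRM ?(ltW z0) // mulrCA; congr (_ * _).
  by rewrite divfK // gt_eqF.
apply: (@le_trans _ _ (rho ^+ 4 * W)); last first.
  by rewrite ler_pM2r // -powR_mulrn // ler_powR.
have rz : 2 * z <= W * rho.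
  rewrite -(ler_pM2l W40) [leRHS]mulrA WW -(ler_pM2r z0) -(mulrA 4 rho) rhoE.
  move: zz1; rewrite expr2; lra.
rewrite -rhoE.
have : (2 * z) ^+ 2 <= (W * rho) ^+ 2 by rewrite lerXn2r ?nnegrE; lra.
rewrite -(ler_pM2r (exprn_gt0 2 (lt_le_trans ltr01 rho1))) => le2.
rewrite mulrAC ler_pdivrMr //; apply: le_trans (le_trans le2 _); lra.
Qed.
Lemma quartic_unstable (R : realType) (W amin amax b : R) (mu : feedback R) :
  0 < W -> amin < amax -> 4 <= b ->
  exists a w y, [/\ amin <= a <= amax, forall t, (1 <= t)%N -> `|w t| <= W,
    trajectory mu (a, b) w y & forall t, 2 ^+ t * W <= `|y t|].
Proof.
move=> W0 lt_a b4.
have b0 : 0 < b by lra.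
have d0 : 0 < amax - amin by lra.
pose e := 4 / W / (amax - amin).
have e0 : 0 < e by rewrite !divr_gt0.
(* With y0 >= 1, y0^b >= y0^4; e makes the invariant hold initially, and W
   makes y0 large enough for outputs to double. *)
pose y0 := 1 + W + e.
have [y [s [y_0 s_0 yS]]] := causal_recursion y0 (amin, amax)
  (fun t h s => adversary W s.1 s.2 (phi b (h 0 ord_max)) (mu t h)).
pose u t := mu t (\row_(i < t.+1) y i).
have yE t : (y t.+1, s t.+1) = adversary W (s t).1 (s t).2 (phi b (y t)) (u t).
  by rewrite yS mxE.
pose len t := (s t).2 - (s t).1.
have advP t : W <= `|y t| -> W / `|y t| `^ b <= len t ->
    [/\ len t * `|y t| `^ b / 2 <= `|y t.+1|, (s t).1 <= (s t.+1).1,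
      (s t.+1).2 <= (s t).2, len t.+1 = W / `|y t| `^ b &
      forall a, (s t.+1).1 <= a <= (s t.+1).2 ->
        `|y t.+1 - u t - a * phi b (y t)| <= W].
  move=> Wy lenW.
  have := @adversaryP R W (s t).1 (s t).2 (phi b (y t)) (u t) (ltW W0).
  rewrite normr_phi // -yE /=; apply=> //.
  by rewrite -normr_gt0 normr_phi // powR_gt0 // (lt_le_trans W0).
have inv t : [/\ 2 ^+ t * W <= `|y t|, W <= `|y t| &
    4 / W * `|y t| ^+ 2 <= len t * `|y t| `^ b].
  elim: t => [|t [IH1 IH2 IH3]].
    rewrite /len y_0 s_0 /= expr0 mul1r ger0_norm; last by rewrite /y0; lra.
    split; [by rewrite /y0; lra|by rewrite /y0; lra|].
    have y01 : 1 <= y0 by rewrite /y0; lra.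
    apply: (@le_trans _ _ ((amax - amin) * y0 ^+ 4)); last first.
      by rewrite ler_pM2l // -powR_mulrn ?ler_powR //; lra.
    have -> : 4 / W = (amax - amin) * e by rewrite /e [RHS]mulrC divfK // gt_eqF.
    rewrite -mulrA ler_pM2l // (exprD _ 2 2) ler_wpM2r ?sqr_ge0 //.
    by apply: (@le_trans _ _ y0); [rewrite /y0; lra|exact: ler_eXnr].
  have [_ fits] := plausible_interval_shrinks W0 IH2 IH3.
  have [le_far _ _ lenE _] := advP t IH2 fits.
  have [dbl inv'] := far_output_escapes W0 b4 IH2 IH3 le_far.
  by rewrite lenE exprS; split=> //; lra.
have invS t : W / `|y t| `^ b <= len t.
  have [_ Wy inv_t] := inv t.
  by have [] := plausible_interval_shrinks W0 Wy inv_t.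
have adv t := advP t (let: And3 _ Wy _ := inv t in Wy) (invS t).
have len0 t : 0 <= len t by apply: le_trans (invS t); rewrite divr_ge0 ?powR_ge0 ?ltW.
have [a aI] : exists a, forall t, (s t).1 <= a <= (s t).2.
  apply: (nested_intervals (l := fun t => (s t).1) (r := fun t => (s t).2)) => t.
  - by have [_ ? ? _ _] := adv t.
  - by have [_ ? ? _ _] := adv t.
  - by rewrite -subr_ge0; exact: len0.
exists a, (fun t => y t - u t.-1 - a * phi b (y t.-1)), y; split.
- by have := aI 0%N; rewrite s_0.
- by case=> // t _ /=; have [_ _ _ _] := adv t; apply.
- by move=> t /=; rewrite -/(u t); ring.
- by move=> t; have [] := inv t.
Qed.

(** * Growth of a trajectory that learns from its own past *)

(** The right-hand side of the recursion is at most (beta / 4) x_(k+1)^2 / x_k,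
    so the ratio x_(k+1) / x_k, at most X at the start, is multiplied by
    q = beta / 4 < 1 until it reaches 1. With q^n X <= 1, at most n steps
    increase x, each by a factor at most X. *)
Lemma damped_growth_bounded (R : realType) (beta X : R) :
  0 <= beta < 4 -> 1 <= X -> exists F, forall (x : nat -> R) (T : nat),
    (forall k, 1 <= x k) -> x 0%N <= X -> x 1%N <= X ->
    (forall k, (k.+2 <= T)%N ->
       x k.+2 <= Num.max (x k.+1) (beta * (x k.+1 - x k))) ->
    x T <= F.
Proof.
move=> /andP[beta0 beta4] X1; pose q := beta / 4.
have q0 : 0 <= q by rewrite divr_ge0.
have q1 : q < 1 by rewrite ltr_pdivrMr // mul1r.
have [n qX] : exists n, q ^+ n * X <= 1.
  have [->|qn0] := eqVneq q 0; first by exists 1%N; rewrite expr1 mul0r.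
  have /cvgrPdist_le/(_ X^-1) : (fun n => q ^+ n) @ \oo --> (0 : R).
    by apply: cvg_expr; rewrite ger0_norm.
  case; first by rewrite invr_gt0; lra.
  move=> n _ /(_ n (leqnn n)) /=; rewrite sub0r normrN ger0_norm ?exprn_ge0 // => qn.
  by exists n; rewrite -ler_pdivlMr ?div1r //; lra.
exists (X ^+ n * X) => x T x1 x0X x1X rec.
have ratio k : (k.+1 <= T)%N -> x k.+1 <= Num.max 1 (q ^+ k * X) * x k.
  elim: k => [|k IHk] kT.
    rewrite expr0 mul1r max_r //; apply: le_trans x1X _.
    by rewrite ler_peMr //; lra.
  have xk := x1 k; have xk1 := x1 k.+1.
  have {}IHk := IHk (ltnW kT).
  set c := q ^+ k * X in IHk.
  have -> : q ^+ k.+1 * X = q * c by rewrite exprS mulrA.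
  have c0 : 0 <= c by rewrite mulr_ge0 ?exprn_ge0 //; lra.
  apply: le_trans (rec k kT) _; rewrite ge_max; apply/andP; split.
    by rewrite ler_peMl ?le_max ?lexx //; lra.
  (* beta (v - w) w <= (beta / 4) v^2 is the square (v - 2 w)^2 >= 0 *)
  have amgm : beta * (x k.+1 - x k) * x k <= q * x k.+1 ^+ 2.
    have : 0 <= beta * (x k.+1 - 2 * x k) ^+ 2 by rewrite mulr_ge0 ?sqr_ge0.
    by rewrite /q; lra.
  rewrite -(ler_pM2r (lt_le_trans ltr01 xk)); apply: le_trans amgm _.
  rewrite expr2 mulrA [leRHS]mulrAC ler_wpM2r //; first lra.
  apply: le_trans (ler_wpM2l q0 IHk) _; rewrite mulrA ler_wpM2r //; first lra.
  by rewrite maxr_pMr // mulr1 ge_max !le_max lexx orbT andbT; lra.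
have geoX i : 1 <= X ^+ i by rewrite exprn_ege1.
have step k : (k.+1 <= T)%N -> x k.+1 <= X * x k.
  move=> kT; apply: le_trans (ratio k kT) _.
  rewrite ler_wpM2r //; first by have := x1 k; lra.
  rewrite ge_max X1 /= ler_piMl //; first lra.
  by rewrite exprn_ile1 // ltW.
have late k : (n <= k)%N -> (k.+1 <= T)%N -> x k.+1 <= x k.
  move=> nk kT; apply: le_trans (ratio k kT) _.
  rewrite max_l ?mul1r //; apply: le_trans qX; rewrite ler_wpM2r //; first lra.
  by rewrite ler_wiXn2l // ltW.
suff H k : (k <= T)%N -> x k <= X ^+ minn k n * X.
  apply: le_trans (H T (leqnn T)) _; rewrite ler_wpM2r //; first lra.
  by rewrite ler_weXn2l // geq_minr.
elim: k => [|k IHk] kT; first by rewrite min0n expr0 mul1r.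
have [nk|kn] := leqP n k.
  apply: le_trans (late k nk kT) _; apply: le_trans (IHk (ltnW kT)) _.
  by rewrite (minn_idPr nk) (minn_idPr (leqW nk)).
apply: le_trans (step k kT) _.
have := IHk (ltnW kT); rewrite (minn_idPl (ltnW kn)) (minn_idPl kn) exprS -mulrA.
by rewrite ler_pM2l //; lra.
Qed.

Fixpoint running_max (R : realType) (z : nat -> R) (t : nat) : R :=
  if t is s.+1 then Num.max (running_max z s) (z t) else z 0%N.

Lemma running_max_attained (R : realType) (z : nat -> R) t :
  exists2 s, (s <= t)%N & running_max z t = z s.
Proof.
elim: t => [|t [s st IHt]]; first by exists 0%N.
rewrite /=; have [le|lt] := leP (z t.+1) (running_max z t).
  by exists s => //; exact: leqW.
by exists t.+1.
Qed.

Lemma running_max_ge (R : realType) (z : nat -> R) t : z t <= running_max z t.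
Proof. by case: t => //= t; rewrite le_max lexx orbT. Qed.

Lemma running_max_nondecreasing (R : realType) (z : nat -> R) :
  {homo running_max z : s t / (s <= t)%N >-> s <= t}.
Proof.
by apply: homo_leq => [//|y x w|t /=]; [exact: le_trans|rewrite le_max lexx].
Qed.

(** The bound on the next output that a consistent estimate with exponent b
    would guarantee at time t. The hypothesis [0 < z s] matters: division by
    zero returns 0. *)
Definition learned_step (R : realType) (W beta : R) (z : nat -> R) (t : nat) :=
  exists2 b, 0 <= b <= beta & forall s, (s < t)%N -> 0 < z s ->
    z t.+1 <= 2 * W * (z t / z s) `^ b + W.

(** Dividing by 3 W absorbs the constants of [learned_step]: for rho >= 1,
    2 W rho^b + W <= 3 W rho^b. *)
Definition log_record (R : realType) (W : R) (z : nat -> R) (k : nat) : R :=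
  ln (running_max z k / (3 * W)).

(** [learned_step] is applied at the time s <= t of the largest output so far:
    that output tells most about the gain. *)
Lemma log_record_recursion (R : realType) (W beta : R) (z : nat -> R) t :
  0 < W -> (forall s, 0 <= z s) -> learned_step W beta z t.+1 ->
  0 < running_max z t ->
  log_record W z t.+2 <=
    Num.max (log_record W z t.+1)
      (beta * (log_record W z t.+1 - log_record W z t)).
Proof.
move=> W0 z0 [b /andP[b0 bbeta] learned] M0; pose x := log_record W z; rewrite -/x.
have D0 : 0 < 3 * W by lra.
have Mt1 : running_max z t <= running_max z t.+1 by exact: running_max_nondecreasing.
have M10 : 0 < running_max z t.+1 by apply: lt_le_trans Mt1.
rewrite {1}/x /log_record /=; have [|lt_z] := leP (z t.+2) (running_max z t.+1).
  by move=> _; rewrite le_max; apply/orP; left; exact: lexx.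
rewrite le_max; apply/orP; right.
have [s st Ms] := running_max_attained z t.
pose rho := running_max z t.+1 / running_max z t.
have rho1 : 1 <= rho by rewrite ler_pdivlMr // mul1r.
have xE : x t.+1 - x t = ln rho.
  rewrite /x /log_record /rho !ln_div ?posrE //; ring.
rewrite xE -ln_powR ler_ln ?posrE ?divr_gt0 ?powR_gt0 //; [|lra|lra].
rewrite ler_pdivrMr //.
have := learned s st; rewrite -Ms => /(_ M0) zle; apply: le_trans zle _.
have le_rho : (z t.+1 / running_max z t) `^ b <= rho `^ beta.
  apply: (@le_trans _ _ (rho `^ b)); last by rewrite ler_powR.
  have zM : z t.+1 / running_max z t <= rho.
    by rewrite ler_pM2r ?invr_gt0 // running_max_ge.
  by apply: ge0_ler_powR; rewrite ?nnegrE ?divr_ge0 ?z0 //; lra.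
have rho_beta : 1 <= rho `^ beta.
  by rewrite -(powRr0 rho) ler_powR //; lra.
nra.
Qed.

Lemma running_maxS_le (R : realType) (G : R -> R) (z : nat -> R) (t : nat) (c : R) :
  (forall u v, 0 <= u -> u <= v -> G u <= G v) ->
  0 <= z t -> z t.+1 <= G (z t) -> running_max z t <= c ->
  running_max z t.+1 <= Num.max c (G c).
Proof.
move=> Ghomo zt0 crude Mc; rewrite /= ge_max !le_max Mc /=; apply/orP; right.
by apply: le_trans crude _; apply: Ghomo (le_trans (running_max_ge z t) Mc).
Qed.

(** While the running maximum is below K = 3 W e its logarithmic record may be
    below 1, where ratios of records are not controlled; but the first passage
    above K overshoots by one application of G at most, as does the step after
    it. These two values start [damped_growth_bounded]. *)
Lemma learning_phase_bounded (R : realType) (W beta : R) (G : R -> R) (m : R) :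
  0 < W -> 0 <= beta < 4 -> (forall u v, 0 <= u -> u <= v -> G u <= G v) ->
  exists F, forall (z : nat -> R) (t0 t1 : nat), (t0 <= t1)%N ->
    (forall t, 0 <= z t) -> (forall t, z t.+1 <= G (z t)) ->
    (forall t, (t0 <= t < t1)%N -> learned_step W beta z t) ->
    running_max z t0 <= m -> running_max z t1 <= F.
Proof.
move=> W0 beta4 Ghomo; have D0 : 0 < 3 * W by lra.
pose K := 3 * W * expR 1.
pose m1 := Num.max m (Num.max K (G K)); pose m2 := Num.max m1 (G m1).
pose X := Num.max 1 (ln (m2 / (3 * W))).
have X1 : 1 <= X by rewrite le_max lexx.
have [F' bnd] := damped_growth_bounded beta4 X1.
exists (Num.max m2 (3 * W * expR F')) => z t0 t1 t01 z0 crude learned Mt0.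
have m1m2 : m1 <= m2 by rewrite le_max lexx.
have crudeM t c := @running_maxS_le R G z t c Ghomo (z0 t) (crude t).
have [ltK|leK] := ltP (running_max z t1) K.
  by rewrite !le_max (ltW ltK) !orbT.
have ex : exists t, (t0 <= t)%N && (K <= running_max z t) by exists t1; rewrite t01.
have [tau /andP[t0tau Ktau] tau_min] := ex_minnP ex.
have taut1 : (tau <= t1)%N by apply: tau_min; rewrite t01.
have Mtau : running_max z tau <= m1.
  move: (t0tau); rewrite leq_eqVlt => /orP[/eqP <-|lt]; first by rewrite le_max Mt0.
  have [s tauE] : exists s, tau = s.+1 by exists tau.-1; rewrite (ltn_predK lt).
  rewrite tauE le_max; apply/orP; right; apply: crudeM; rewrite ltW // ltNge.
  apply/negP => Ks; have /tau_min : (t0 <= s)%N && (K <= running_max z s).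
    by rewrite Ks andbT -ltnS -tauE.
  by rewrite tauE ltnn.
have Mtau1 : running_max z tau.+1 <= m2 by exact: crudeM.
have M_ge k : K <= running_max z (tau + k).
  by apply: le_trans Ktau _; apply: running_max_nondecreasing; exact: leq_addr.
have K0 : 0 < K by rewrite mulr_gt0 // expR_gt0.
have logM k : running_max z (tau + k) <= m2 ->
    log_record W z (tau + k) <= X.
  move=> le_m2; rewrite le_max; apply/orP; right.
  have M0 := lt_le_trans K0 (M_ge k).
  rewrite /log_record ler_ln ?posrE ?divr_gt0 ?ler_pM2r ?invr_gt0 //.
  exact: lt_le_trans le_m2.
have le_F' : log_record W z t1 <= F'.
  rewrite -(subnKC taut1).
  apply: (bnd (fun k => log_record W z (tau + k))) => [k|||k kT].
  - rewrite /log_record -[leLHS]expRK ler_ln ?posrE ?expR_gt0 //; last first.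
      by rewrite divr_gt0 // (lt_le_trans K0).
    by rewrite ler_pdivlMr // mulrC; exact: M_ge.
  - by apply: logM; rewrite addn0; exact: le_trans m1m2.
  - by apply: logM; rewrite addn1.
  - rewrite !addnS; apply: log_record_recursion => //.
      apply: learned; rewrite (leq_trans t0tau) ?leqW ?leq_addr //=.
      by rewrite ltn_subRL addnS in kT.
    by apply: lt_le_trans (M_ge k).
rewrite le_max; apply/orP; right.
rewrite mulrC -ler_pdivrMr //.
rewrite -[leLHS]lnK ?posrE ?divr_gt0 ?ler_expR //.
by apply: lt_le_trans (lt_le_trans K0 leK) _.
Qed.

Lemma last_drop (r : nat -> nat) t :
  (forall s, (s < t)%N -> (r s <= r s.+1)%N) \/
  (exists s, [/\ (s < t)%N, (r s.+1 < r s)%N &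
     forall s', (s < s' < t)%N -> (r s' <= r s'.+1)%N]).
Proof.
elim: t => [|t IHt]; first by left.
have [noDrop|drop] := leqP (r t) (r t.+1); last first.
  by right; exists t; split=> // s' /andP[lt]; rewrite ltnS leqNgt lt.
case: IHt => [none|[s [st drop later]]].
  by left => s; rewrite ltnS leq_eqVlt => /predU1P[->|/none].
right; exists s; split=> //; first exact: leqW.
move=> s' /andP[ss']; rewrite ltnS leq_eqVlt => /predU1P[->//|s't].
by apply: later; rewrite ss'.
Qed.

Lemma nonincreasing_rank (r : nat -> nat) :
  (forall t, (r t.+1 <= r t)%N) -> {homo r : s t / (s <= t)%N >-> (t <= s)%N}.
Proof. by apply: homo_leq => // y x w xy yw; exact: leq_trans yw xy. Qed.

(** Induction on the number n of drops of the rank r. Before the last drop the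
    induction hypothesis applies; the drop itself costs one application of G,
    and from there on every step is a learned one. The bound F is chosen before
    the trajectory, which is what makes the final estimate uniform. *)
Lemma finitely_many_lessons_bounded (R : realType) (W beta : R) (G : R -> R)
    (m : R) (n : nat) :
  0 < W -> 0 <= beta < 4 -> (forall u v, 0 <= u -> u <= v -> G u <= G v) ->
  exists F, forall (z : nat -> R) (r : nat -> nat),
    (forall t, 0 <= z t) -> (forall t, z t.+1 <= G (z t)) ->
    (forall t, (r t.+1 <= r t)%N) ->
    (forall t, (r t <= r t.+1)%N -> learned_step W beta z t) ->
    z 0%N <= m -> forall t, (r 0%N <= r t + n)%N -> running_max z t <= F.
Proof.
move=> W0 beta4 Ghomo; elim: n => [|n [F IHn]].
  have [F bnd] := learning_phase_bounded m W0 beta4 Ghomo.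
  exists F => z r z0 crude rS learned zm t; rewrite addn0 => r0t.
  apply: (bnd z 0%N t) => // s /andP[_ st]; apply: learned.
  have rm := nonincreasing_rank rS.
  by apply: leq_trans (rm _ _ (leq0n s)) (leq_trans r0t (rm _ _ st)).
have [F0 bnd0] := learning_phase_bounded m W0 beta4 Ghomo.
have [F1 bnd1] := learning_phase_bounded (Num.max F (G F)) W0 beta4 Ghomo.
exists (Num.max F0 F1) => z r z0 crude rS learned zm t r0t.
have [none|[s [st drop later]]] := last_drop r t.
  rewrite le_max (bnd0 z 0%N t) // => s /andP[_ st]; apply: learned; exact: none.
rewrite le_max (bnd1 z s.+1 t) ?orbT // => [s' s's|].
  by apply: learned; apply: later.
have Ms : running_max z s <= F.
  apply: (IHn z r) => //; apply: leq_trans r0t _.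
  rewrite addnS -addSn leq_add2r.
  exact: leq_ltn_trans (nonincreasing_rank rS st) drop.
exact: (@running_maxS_le R G z s F Ghomo (z0 s) (crude s)).
Qed.

(** * The certainty-equivalence law *)

Definition consistent (R : realType) (W : R) (P : set (R * R))
    (y u : nat -> R) (t : nat) : set (R * R) :=
  [set p | P p /\ forall s, (s < t)%N ->
     `|y s.+1 - u s - p.1 * phi p.2 (y s)| <= W].

Definition estimate (R : realType) (W : R) (P : set (R * R))
    (y u : nat -> R) (t : nat) : R * R :=
  xget (0, 0) (consistent W P y u t).

(** The inputs applied before time t, recomputed from the outputs alone: testing
    consistency needs the past inputs, while a feedback only sees outputs. *)
Fixpoint past_inputs (R : realType) (W : R) (P : set (R * R))
    (y : nat -> R) (t : nat) : nat -> R :=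
  if t is s.+1 then
    let u := past_inputs W P y s in
    let p := estimate W P y u s in
    fun k => if k == s then - (p.1 * phi p.2 (y s)) else u k
  else fun=> 0.

(** Beyond time t the values are irrelevant, by [past_inputs_causal]. *)
Definition history (R : realType) (t : nat) (h : 'rV[R]_t.+1) (k : nat) : R :=
  h 0 (inord k).

Definition certainty_equivalence (R : realType) (W : R) (P : set (R * R)) :
    feedback R :=
  fun t h => past_inputs W P (history h) t.+1 t.

Lemma past_inputs_causal (R : realType) (W : R) (P : set (R * R))
    (y y' : nat -> R) (t : nat) :
  (forall k, (k < t)%N -> y k = y' k) ->
  past_inputs W P y t =1 past_inputs W P y' t.
Proof.
elim: t => [//|t IHt] yy' k /=.
have {}IHt := IHt (fun k kt => yy' k (leqW kt)).
have estE : estimate W P y (past_inputs W P y t) t =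
    estimate W P y' (past_inputs W P y' t) t.
  rewrite /estimate; congr xget.
  apply/seteqP; split=> p [Pp pW]; split=> // s st; move: (pW s st).
    by rewrite (IHt s) (yy' s.+1 _) ?(yy' s _) // ltnW.
  by rewrite (IHt s) (yy' s.+1 _) ?(yy' s _) // ltnW.
by rewrite estE (IHt k) (yy' t (ltnSn t)).
Qed.

Lemma past_inputs_stable (R : realType) (W : R) (P : set (R * R))
    (y : nat -> R) (s t : nat) :
  (s < t)%N -> past_inputs W P y t s = past_inputs W P y s.+1 s.
Proof.
elim: t => [//|t IHt]; rewrite ltnS leq_eqVlt => /predU1P[->//|st].
by rewrite /= (ltn_eqF st) IHt.
Qed.

(** The true parameter is always consistent, so the choice of an estimate never
    falls back on its default value. *)
Lemma certainty_equivalenceP (R : realType) (W : R) (P : set (R * R))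
    (p : R * R) (w y : nat -> R) :
  P p -> (forall t, (1 <= t)%N -> `|w t| <= W) ->
  trajectory (certainty_equivalence W P) p w y ->
  exists u est, [/\ forall t, y t.+1 = p.1 * phi p.2 (y t) + u t + w t.+1,
    forall t, consistent W P y u t p,
    forall t, consistent W P y u t (est t) &
    forall t, u t = - ((est t).1 * phi (est t).2 (y t))].
Proof.
move=> Pp wW traj.
pose u t := past_inputs W P y t.+1 t; pose est t := estimate W P y u t.
have uE t : certainty_equivalence W P (\row_(i < t.+1) y i) = u t.
  apply: past_inputs_causal => k kt.
  by rewrite /history mxE inordK.
have yS t : y t.+1 = p.1 * phi p.2 (y t) + u t + w t.+1 by rewrite traj uE.
have pC t : consistent W P y u t p.
  split=> // s st; rewrite yS [X in `|X|](_ : _ = w s.+1); last by ring.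
  exact: wW.
have estE t : est t = estimate W P y (past_inputs W P y t) t.
  rewrite /est /estimate; congr xget; apply/seteqP; split=> q [Pq qW]; split=> // s st.
    by rewrite past_inputs_stable // qW.
  by rewrite /u -(past_inputs_stable _ _ _ st) qW.
exists u, est; split=> // t; first by apply: xgetI (pC t).
by rewrite estE {1}/u /= eqxx.
Qed.

Lemma consistentS (R : realType) (W : R) (P : set (R * R)) (y u : nat -> R) t q :
  consistent W P y u t.+1 q -> consistent W P y u t q.
Proof. by move=> [Pq qW]; split=> // s st; apply: qW; exact: leqW. Qed.

(** The true parameter does not enter: a and a' both explain the output after
    time s with the exponent b, so |a' - a| |y_s|^b <= 2 W, and a' explains the
    output after time t. *)
Lemma unrefuted_exponent_bound (R : realType) (W : R) (P : set (R * R))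
    (y u : nat -> R) (a a' b : R) t s :
  0 < b -> u t = - (a * phi b (y t)) ->
  consistent W P y u t (a, b) -> consistent W P y u t.+1 (a', b) ->
  (s < t)%N -> 0 < `|y s| ->
  `|y t.+1| <= 2 * W * (`|y t| / `|y s|) `^ b + W.
Proof.
move=> b0 uE [_ aC] [_ a'C] st ys0.
have ysb : 0 < `|y s| `^ b by exact: powR_gt0.
have err : `|a' - a| * `|y s| `^ b <= 2 * W.
  rewrite -normr_phi // -normrM.
  have -> : (a' - a) * phi b (y s) =
    (y s.+1 - u s - a * phi b (y s)) - (y s.+1 - u s - a' * phi b (y s)) by ring.
  apply: le_trans (ler_normB _ _) _.
  have := aC s st; have := a'C s (leqW st) => /=; lra.
have -> : y t.+1 = (a' - a) * phi b (y t) + (y t.+1 - u t - a' * phi b (y t)).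
  by rewrite uE; ring.
apply: le_trans (ler_normD _ _) _; apply: lerD; last exact: a'C.
rewrite normrM normr_phi //.
have -> : `|y t| `^ b = `|y s| `^ b * (`|y t| / `|y s|) `^ b.
  by rewrite -powRM ?divr_ge0 // mulrC divfK // gt_eqF.
by rewrite mulrA ler_wpM2r // powR_ge0.
Qed.

Lemma crude_bound (R : realType) (W A : R) (p q : R * R) (y u v : R) :
  0 < p.2 <= 4 -> 0 < q.2 <= 4 -> `|p.1| <= A -> `|q.1| <= A -> `|v| <= W ->
  `|p.1 * phi p.2 y - q.1 * phi q.2 y + v| <= 2 * A * (1 + `|y|) ^+ 4 + W.
Proof.
have term (x : R * R) : 0 < x.2 <= 4 -> `|x.1| <= A ->
    `|x.1 * phi x.2 y| <= A * (1 + `|y|) ^+ 4.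
  move=> /andP[x0 x4] xA; rewrite normrM normr_phi // ler_pM ?powR_ge0 //.
  have y0 := normr_ge0 y.
  rewrite -powR_mulrn; last lra.
  apply: (@le_trans _ _ ((1 + `|y|) `^ x.2)); last by rewrite ler_powR //; lra.
  by apply: ge0_ler_powR; rewrite ?nnegrE //; lra.
move=> pb qb pA qA vW; apply: le_trans (ler_normD _ _) _; apply: lerD => //.
apply: le_trans (ler_normB _ _) _.
have := term p pb pA; have := term q qb qA; lra.
Qed.

Definition surviving (R : realType) (W : R) (P : set (R * R)) (B : {fset R})
    (y u : nat -> R) (t : nat) : nat :=
  #|` [fset b in B | `[< exists a, consistent W P y u t (a, b) >]]|%fset.

Lemma survivingS (R : realType) (W : R) (P : set (R * R)) (B : {fset R})
    (y u : nat -> R) (t : nat) :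
  (surviving W P B y u t.+1 <= surviving W P B y u t)%N.
Proof.
apply/fsubset_leq_card/fsubsetP => b; rewrite !inE => /andP[-> /asboolP[a aC]].
by apply/asboolP; exists a; exact: consistentS.
Qed.

(** Refutation is permanent, so each step at which the picked exponent fails
    lowers the number of survivors; the other steps are the learned ones. *)
Lemma picked_exponent_survives (R : realType) (W : R) (P : set (R * R)) (B : {fset R})
    (y u : nat -> R) (t : nat) (q : R * R) :
  q.2 \in B -> consistent W P y u t q ->
  (surviving W P B y u t <= surviving W P B y u t.+1)%N ->
  exists a, consistent W P y u t.+1 (a, q.2).
Proof.
move=> qB qC noDrop; apply: contrapT => refuted.
suff : (surviving W P B y u t.+1 < surviving W P B y u t)%N by rewrite ltnNge noDrop.
apply: fproper_ltn_card; rewrite fproperE; apply/andP; split.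
  apply/fsubsetP => b; rewrite !inE => /andP[-> /asboolP[a aC]].
  by apply/asboolP; exists a; exact: consistentS.
apply/fsubsetP => /(_ q.2); rewrite !inE qB /= => /(_ _)/asboolP-refutes.
apply/refuted/refutes/asboolP; exists q.1; by case: q qC {qB refuted refutes}.
Qed.

(** * The maximal exponent and the equivalence *)

Lemma fset_max_ge (R : realType) (B : {fset R}) b : b \in B -> b <= fset_max B.
Proof. by move=> bB; apply: le_bigmax_seq. Qed.

Lemma fset_max_lt (R : realType) (B : {fset R}) (c : R) : 0 < c ->
  (forall b, b \in B -> b < c) -> fset_max B < c.
Proof.
move=> c0 Bc; rewrite /fset_max big_seq; apply: bigmax_lt => // b; exact: Bc.
Qed.

Lemma subquartic_uniformly_bounded (R : realType) (W amin amax : R) (B : {fset R}) :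
  0 < W -> B != fset0 -> (forall b, b \in B -> 0 < b) -> fset_max B < 4 ->
  let P := `[amin, amax] `*` [set` B] in
  forall Y, (uniform_bound (certainty_equivalence W P) W P Y < +oo)%E.
Proof.
move=> W0 /fset0Pn[b1 b1B] B_gt0 B4 P Y.
have beta0 : 0 <= fset_max B by rewrite (le_trans (ltW (B_gt0 _ b1B))) ?fset_max_ge.
pose A := `|amin| + `|amax|; pose G x := 2 * A * (1 + x) ^+ 4 + W.
have A0 : 0 <= A by rewrite addr_ge0.
have G_homo x x' : 0 <= x -> x <= x' -> G x <= G x'.
  move=> x0 xx'; rewrite lerD2r ler_wpM2l ?mulr_ge0 //.
  by rewrite lerXn2r ?nnegrE; lra.
have PA (p : R * R) : P p -> `|p.1| <= A /\ 0 < p.2 <= 4.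
  move=> [/= ]; rewrite in_itv /= => /andP[p1 p2] pB; split.
    rewrite ler_norml /A; have := ler_norm amax; have := ler_norm (- amin).
    have := normr_ge0 amax; have := normr_ge0 amin; rewrite normrN; lra.
  by rewrite B_gt0 //= ltW // (le_lt_trans _ B4) ?fset_max_ge.
(* at most #|B| exponents can be refuted *)
have [F bnd] : exists F, forall (z : nat -> R) (r : nat -> nat),
    (forall t, 0 <= z t) -> (forall t, z t.+1 <= G (z t)) ->
    (forall t, (r t.+1 <= r t)%N) ->
    (forall t, (r t <= r t.+1)%N -> learned_step W (fset_max B) z t) ->
    z 0%N <= Y -> forall t, (r 0%N <= r t + #|` B|)%N -> running_max z t <= F.
  by apply: finitely_many_lessons_bounded; rewrite ?beta0.
apply: (@le_lt_trans _ _ F%:E); last exact: ltry.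
apply: ge_ereal_sup => _ [y [p [w [Pp y0 /admissible_disturbanceP wW traj]]] <-].
have [u [est [yS pC estC uE]]] := certainty_equivalenceP Pp wW traj.
apply: sup_abs_le => t.
apply: le_trans (running_max_ge (fun t => `|y t|) t) _.
apply: (bnd _ (surviving W P B y u)) => // [s|s|s noDrop|].
- have [pA pb] := PA _ Pp; have [qA qb] := PA _ (estC s).1.
  have -> : y s.+1 = p.1 * phi p.2 (y s) - (est s).1 * phi (est s).2 (y s) + w s.+1.
    by rewrite yS uE.
  by apply: crude_bound => //; exact: wW.
- exact: survivingS.
- have [_ estB] := (estC s).1.
  have [a' a'C] := picked_exponent_survives estB (estC s) noDrop.
  exists (est s).2; first by rewrite fset_max_ge // ltW // B_gt0.
  move=> s' s's ys0.
  apply: (unrefuted_exponent_bound (B_gt0 _ estB) (uE s)) a'C s's ys0.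
  by case: (est s) (estC s).
- apply: (@leq_trans #|` B|); last exact: leq_addl.
  by apply: fsubset_leq_card; apply/fsubsetP => b; rewrite !inE => /andP[].
Qed.

Theorem theorem3p4 (R : realType) (W amin amax : R) (B : {fset R})
    (W_gt0 : 0 < W) (lt_a : amin < amax)
    (B_neq0 : B != fset0) (B_gt0 : forall b : R, b \in B -> 0 < b) :
  (robustly_stabilizable W (`[amin, amax] `*` [set` B]) <-> fset_max B < 4)
  /\
  (fset_max B < 4 ->
   exists mu : feedback R, forall Y : R, 0 <= Y ->
     (uniform_bound mu W (`[amin, amax] `*` [set` B]) Y < +oo)%E).
Proof.
split; last first.
  move=> B4; eexists => Y _; exact: subquartic_uniformly_bounded.
split=> [[mu stab]|B4]; last first.
  exists (certainty_equivalence W (`[amin, amax] `*` [set` B])) => p w y Pp adm traj.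
  have := @subquartic_uniformly_bounded R W amin amax B W_gt0 B_neq0 B_gt0 B4 `|y 0%N|.
  apply: le_lt_trans; apply: ereal_sup_ubound; exists y => //.
  by exists p, w.
apply: fset_max_lt => // b bB; rewrite ltNge; apply/negP => b4.
have [a [w [y [aI wW traj y_far]]]] := quartic_unstable mu W_gt0 lt_a b4.
have /sup_abs_lty[M yM] : (sup_abs y < +oo)%E.
  apply: stab traj; last exact/admissible_disturbanceP.
  by split; rewrite //= in_itv.
(* 2^t W <= |y_t| <= M for all t contradicts 2^t > M / W for some t *)
have := upper_nthrootP (leqnn (Num.bound (M / W))).
rewrite ltr_pdivrMr // ltNge; apply/negP/negPn.
exact: le_trans (y_far _) (yM _).
Qed.
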